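(* Let $G$ be a topological group, let $X$ be a compact Hausdorff space, and let $\mathcal{H}$ be any one of the hyperspaces $\mathcal{H}_1,\mathcal{H}_2,\mathcal{H}_3$ of $X$. Let $\theta$ be a topological partial action of $G$ on $X$. If $G*X$ is closed in $G\times X$, then $G*\mathcal{H}$ is closed in $G\times\mathcal{H}$.
   Context: Partial actions. A (set-theoretic) partial action of a group $G$ on a set $X$ is a partially defined function $\theta:G\times X\dashrightarrow X$, $(g,x)\mapsto g\cdot x$ (write $\exists g\cdot x$ if $g\cdot x$ is defined), such that for all $g,h\in G$, $x\in X$: (PA1) if $\exists g\cdot x$ then $\exists g^{-1}\cdot(g\cdot x)$ and $g^{-1}\cdot(g\cdot x)=x$; (PA2) if $\exists g\cdot(h\cdot x)$ then $\exists (gh)\cdot x$ and $g\cdot(h\cdot x)=(gh)\cdot x$; (PA3) $\exists 1\cdot x$ and $1\cdot x=x$. Put $G*X=\{(g,x)\in G\times X:\exists g\cdot x\}$ (the domain of $\theta$) and $X_g=\{x\in X:\exists g^{-1}\cdot x\}$; then $\theta$ is determined by the bijections $\theta_g:X_{g^{-1}}\to X_g$, $x\mapsto g\cdot x$, and one writes $\theta=(\theta_g,X_g)_{g\in G}$. For $G$ a topological group and $X$ a topological space, $\theta$ is a topological partial action if every $X_g$ is open in $X$ and every $\theta_g$ is a homeomorphism. Hyperspaces. $\mathcal{H}_1=2^X$ is the set of non-empty compact subsets of $X$, with the Vietoris topology, generated by the sets $\langle U_1,\dots,U_n\rangle_{\mathcal{H}_1}=\{A\in\mathcal{H}_1: A\subseteq\bigcup_{i=1}^nU_i,\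 A\cap U_i\ne\emptyset\ (1\le i\le n)\}$ for non-empty open $U_1,\dots,U_n\subseteq X$; $\langle\emptyset\rangle:=\emptyset$. $\mathcal{H}_2=\{C\in\mathcal{H}_1: C\text{ connected}\}$ and $\mathcal{H}_3=\{F\in\mathcal{H}_1: F\text{ finite}\}$ carry the subspace topology, and $\langle U_1,\dots,U_n\rangle_{\mathcal{H}_i}=\mathcal{H}_i\cap\langle U_1,\dots,U_n\rangle_{\mathcal{H}_1}$. In particular $\langle U\rangle_{\mathcal{H}}=\{A\in\mathcal{H}:A\subseteq U\}$. Induced partial action. $2^{\theta}=(2^{\theta_g},\langle X_g\rangle_{\mathcal{H}})_{g\in G}$ with $2^{\theta_g}:\langle X_{g^{-1}}\rangle_{\mathcal{H}}\to\langle X_g\rangle_{\mathcal{H}}$, $A\mapsto\theta_g(A)$, is a topological partial action of $G$ on $\mathcal{H}$; its domain is $G*\mathcal{H}=\{(g,A)\in G\times\mathcal{H}: A\subseteq X_{g^{-1}}\}$. *)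

(* Defs.v *)
From HB Require Import structures.
From mathcomp Require Import all_boot all_order all_algebra monoid.
From mathcomp Require Import all_classical topology.

Set Implicit Arguments.
Unset Strict Implicit.
Unset Printing Implicit Defensive.

Local Open Scope classical_set_scope.
Local Open Scope group_scope.

HB.mixin Record isTopologicalGroup G & Group G & Topological G := {
  mulg_continuous : continuous (fun p : G * G => p.1 * p.2);
  invg_continuous : continuous (fun x : G => x^-1)
}.

#[short(type="topologicalGroupType")]
HB.structure Definition TopologicalGroup :=
  {G of Group G & Topological G & isTopologicalGroup G}.

(* [act g x = Some y] means that [g . x] is defined and equal to [y]. *)
Record partial_action (G : groupType) (X : Type) := PartialAction {
  pact :> G -> X -> option X;
  pactV : forall g x y, pact g x = Some y -> pact g^-1 y = Some x;
  pactM : forall g h x y z,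
    pact h x = Some y -> pact g y = Some z -> pact (g * h) x = Some z;
  pact1 : forall x, pact 1 x = Some x
}.

Section PartialAction.
Context {G : groupType} {X : Type} (theta : partial_action G X).

Definition pact_graph_dom : set (G * X) := [set p | isSome (theta p.1 p.2)].

(* The set X_g of points x such that g^-1 . x is defined. *)
Definition pact_set (g : G) : set X := [set x | isSome (theta g^-1 x)].

(* theta_g, extended by the identity outside of X_(g^-1). *)
Definition pact_fun (g : G) (x : X) : X := odflt x (theta g x).

Lemma pact_setV g x : pact_set g^-1 x <-> isSome (theta g x).
Proof. by rewrite /pact_set/= invgK. Qed.

Lemma pact_funE g x : pact_set g^-1 x -> theta g x = Some (pact_fun g x).
Proof. by move/pact_setV; rewrite /pact_fun; case: (theta g x). Qed.

End PartialAction.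

(* A homeomorphism from the subspace A of T onto the subspace B of U; only the
   restriction of f to A matters. *)
Definition homeomorphism_between {T U : topologicalType}
    (A : set T) (B : set U) (f : T -> U) :=
  exists h : U -> T,
    [/\ set_fun A B f, set_fun B A h, {in A, cancel f h}, {in B, cancel h f} &
        {within A, continuous f} /\ {within B, continuous h}].

Record top_partial_action (G : topologicalGroupType) (X : topologicalType) :=
  TopPartialAction {
  top_pact :> partial_action G X;
  pact_set_open : forall g, open (pact_set top_pact g);
  pact_homeo : forall g, homeomorphism_between
    (pact_set top_pact g^-1) (pact_set top_pact g) (pact_fun top_pact g)
}.

(* The hyperspace 2^X. *)
Record compacts (X : topologicalType) := Compacts {
  compacts_set :> set X;
  compacts_neq0 : compacts_set !=set0;
  compacts_compact : compact compacts_set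
}.

Lemma compacts_inj (X : topologicalType) : injective (@compacts_set X).
Proof.
move=> [A A0 Ac] [B B0 Bc] /= AB; subst B.
by rewrite (Prop_irrelevance A0 B0) (Prop_irrelevance Ac Bc).
Qed.

HB.instance Definition _ (X : topologicalType) := gen_eqMixin (compacts X).
HB.instance Definition _ (X : topologicalType) := gen_choiceMixin (compacts X).

Definition vietoris_set {X : topologicalType} {n : nat} (U : 'I_n -> set X) :
    set (compacts X) :=
  [set A : compacts X |
    A `<=` \bigcup_i U i /\ forall i, A `&` U i !=set0].

Definition vietoris_subbase {X : topologicalType} : set (set (compacts X)) :=
  [set B | exists n (U : 'I_n.+1 -> set X),
     (forall i, open (U i) /\ U i !=set0) /\ B = vietoris_set U].

HB.instance Definition _ (X : topologicalType) :=
  isSubBaseTopological.Build (compacts X) vietoris_subbase id.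

Variant hyperspace_kind := AllCompacts | Continua | FiniteSubsets.

Definition hyperspace_set {X : topologicalType} (k : hyperspace_kind) :
    set (compacts X) :=
  match k with
  | AllCompacts => setT
  | Continua => [set C : compacts X | connected C]
  | FiniteSubsets => [set F : compacts X | finite_set F]
  end.

(* Carries the subspace topology, as every [set_type]. *)
Notation hyperspace X k := (set_type (@hyperspace_set X k)).

Section Induced.
Context {G : topologicalGroupType} {X : topologicalType}.
Variables (theta : top_partial_action G X) (k : hyperspace_kind).
Implicit Types (A B : hyperspace X k) (g h : G).

Definition hset A : set X := \val A.

Lemma hset_inj : injective hset.
Proof. by move=> A B /compacts_inj/val_inj. Qed.

Lemma pact_fun_within g (A : set X) : A `<=` pact_set theta g^-1 ->
  {within A, continuous (pact_fun theta g)}.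
Proof.
move=> sA; have [h [_ _ _ _ [cf _]]] := pact_homeo theta g.
exact: continuous_subspaceW cf.
Qed.

Lemma image_neq0 g A : pact_fun theta g @` hset A !=set0.
Proof. by have [x Ax] := compacts_neq0 (\val A); exists (pact_fun theta g x), x. Qed.

Lemma image_compact g A : hset A `<=` pact_set theta g^-1 ->
  compact (pact_fun theta g @` hset A).
Proof.
move=> sA; apply: continuous_compact; first exact: pact_fun_within.
exact: compacts_compact.
Qed.

Definition image_compacts g A (sA : hset A `<=` pact_set theta g^-1) :=
  Compacts (image_neq0 g A) (image_compact sA).

Lemma image_hyperspace g A (sA : hset A `<=` pact_set theta g^-1) :
  image_compacts sA \in hyperspace_set k.
Proof.
rewrite inE; have cf := pact_fun_within sA; have HA := set_valP A.
have: (image_compacts sA : set X) = pact_fun theta g @` hset A by [].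
rewrite /hset in cf *; move: (image_compacts sA) (\val A) HA cf => C B + cf.
case: k => //= HB CE; rewrite CE; last exact: finite_image.
exact: connected_continuous_connected.
Qed.

Definition induced_act g A : option (hyperspace X k) :=
  match pselect (hset A `<=` pact_set theta g^-1) with
  | left sA => Some (SigSub (image_hyperspace sA))
  | right _ => None
  end.

Lemma induced_actP g A B : induced_act g A = Some B <->
  hset A `<=` pact_set theta g^-1 /\ hset B = pact_fun theta g @` hset A.
Proof.
rewrite /induced_act; case: pselect => sA; split=> //.
- by move=> [<-].
- by move=> [_ BA]; congr Some; apply: hset_inj; rewrite BA.
- by case.
Qed.

Lemma induced_actV g A B :
  induced_act g A = Some B -> induced_act g^-1 B = Some A.
Proof.
move=> /induced_actP[sA BA]; apply/induced_actP.
have K x : hset A x -> theta g^-1 (pact_fun theta g x) = Some x.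
  by move=> /sA sx; exact: pactV (pact_funE sx).
rewrite BA; split.
  by move=> _ [x Ax <-]; apply/pact_setV; rewrite K.
rewrite image_comp; apply/seteqP; split => [x Ax|_ [x Ax <-]].
  by exists x => //=; rewrite /pact_fun K.
by rewrite /= {1}/pact_fun K.
Qed.

Lemma induced_actM g h A B C : induced_act h A = Some B ->
  induced_act g B = Some C -> induced_act (g * h) A = Some C.
Proof.
move=> /induced_actP[sA BA] /induced_actP[sB CB]; apply/induced_actP.
have K x : hset A x ->
    theta (g * h) x = Some (pact_fun theta g (pact_fun theta h x)).
  move=> Ax; apply: pactM (pact_funE (sA _ Ax)) _.
  by apply: pact_funE; apply: sB; rewrite BA; exists x.
split; first by move=> x Ax; apply/pact_setV; rewrite K.
rewrite CB BA image_comp; apply: eq_imagel => x Ax /=.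
by rewrite [in RHS]/pact_fun K.
Qed.

Lemma induced_act1 A : induced_act 1 A = Some A.
Proof.
apply/induced_actP; split; first by move=> x _; apply/pact_setV; rewrite pact1.
rewrite -[LHS]image_id; apply: eq_imagel => x _.
by rewrite /pact_fun pact1.
Qed.

(* 2^theta, given by A |-> theta_g(A) for A included in X_(g^-1). *)
Definition induced_pact : partial_action G (hyperspace X k) :=
  PartialAction induced_actV induced_actM induced_act1.

Lemma induced_pact_domE : pact_graph_dom induced_pact =
  [set p | hset p.2 `<=` pact_set theta p.1^-1].
Proof.
apply/seteqP; split => -[g A] /=; rewrite /pact_graph_dom /= /induced_act.
  by case: pselect.
by case: pselect.
Qed.

End Induced.

(* Main.v *)
Require Import Defs.
From mathcomp Require Import all_boot all_order all_algebra monoid.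
From mathcomp Require Import all_classical topology.

(** A set [A] belongs to the domain of [g] precisely when all its points do, so
    closedness of the induced domain is tested one point [x] of [A] at a time.
    Suppose that [(g, A)] is a limit of pairs [(h, B)] of the induced domain,
    and let [U] be a neighbourhood of [x].  Meeting [U] is an open condition in
    the Vietoris topology ([open_compacts_hit]), so some pair [(h, B)], with
    [h] as close to [g] as desired, has a point [y] of [B] in [U]; and [h] acts
    on [y], because it acts on all of [B].  Hence [(g, x)] is a limit of points
    of the domain of [theta], which is closed, so [g] acts on [x]. *)

Local Open Scope classical_set_scope.

Lemma open_vietoris_set (X : topologicalType) (n : nat)
    (U : 'I_n.+1 -> set X) :
  (forall i, open (U i) /\ U i !=set0) -> open (vietoris_set U).
Proof.
move=> oU; exists [set vietoris_set U]; last by rewrite bigcup_set1.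
by move=> _ ->; apply: (finI_from1 id); exists n, U.
Qed.

(** For nonempty [U] this is the subbasic set of the pair [X, U]: the component
    [X] makes the covering condition void. *)
Lemma open_compacts_hit (X : topologicalType) (U : set X) :
  open U -> open [set A : compacts X | A `&` U !=set0].
Proof.
move=> oU; have [->|/set0P U0] := eqVneq U set0.
  rewrite [X in open X](_ : _ = set0); first exact: open0.
  by apply/seteqP; split=> [A [? []]|].
pose V (i : 'I_2) := if i == ord0 then setT else U.
rewrite [X in open X](_ : _ = vietoris_set V).
  apply: open_vietoris_set => i; rewrite /V; case: ifP => _ //.
  by split; [exact: openT | case: U0 => x _; exists x].
apply/seteqP; split=> [A AU|A [_ /(_ ord_max)]] //; split=> [x _|i].
  by exists ord0.
rewrite /V; case: ifP => _ //; rewrite setIT; exact: compacts_neq0.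
Qed.

Lemma nbhs_hyperspace_hit (X : topologicalType) (k : hyperspace_kind)
    (A : hyperspace X k) (x : X) (U : set X) :
  hset A x -> nbhs x U -> nbhs A [set B : hyperspace X k | hset B `&` U !=set0].
Proof.
rewrite nbhsE => Ax -[O [oO Ox] OU].
have : nbhs A [set B : hyperspace X k | hset B `&` O !=set0].
  apply: open_nbhs_nbhs; split; last by exists x.
  by exists [set B : compacts X | B `&` O !=set0] => //; exact: open_compacts_hit.
by apply: filterS => B [y [By Oy]]; exists y; split=> //; exact: OU.
Qed.

Theorem proposition3p5 (G : topologicalGroupType) (X : topologicalType)
    (cptX : compact [set: X]) (hausX : hausdorff_space X)
    (k : hyperspace_kind) (theta : top_partial_action G X)
    (clGX : closed (pact_graph_dom theta)) :
  closed (pact_graph_dom (induced_pact theta k)).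
Proof.
rewrite induced_pact_domE => -[g A] clA x Ax; apply/pact_setV.
apply: (clGX (g, x)) => W [[V U] /= [nV nU] VUW].
have [|[h B] [/= hB [Vh [y [By Uy]]]]] :=
  clA (V `*` [set B : hyperspace X k | hset B `&` U !=set0]).
  by exists (V, [set B : hyperspace X k | hset B `&` U !=set0]) => //; split=> //;
     exact: nbhs_hyperspace_hit nU.
exists (h, y); split; last exact: VUW.
by apply/pact_setV; exact: hB.
Qed.
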